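(* Let $\lambda=(\lambda_1,\ldots,\lambda_\ell)$ and $\mu$ be partitions. Then \[ h_\lambda[\Xi_\mu] \;=\; \sum_{\pi \,\vdash\!\!\vdash\, \{\!\!\{ 1^{\lambda_1},2^{\lambda_2},\ldots,\ell^{\lambda_\ell}\}\!\!\}} H_{\tilde m(\pi),\mu}, \] where the sum runs over all multiset partitions $\pi$ of the multiset $\{\!\!\{ 1^{\lambda_1},\ldots,\ell^{\lambda_\ell}\}\!\!\}$ and, for partitions $\nu,\mu$, $H_{\nu,\mu}:=\langle h_{|\mu|-|\nu|}h_\nu,\,p_\mu\rangle$.
   Context: $Sym=\mathbb{Q}[p_1,p_2,\ldots]$ is the ring of symmetric functions with power sums $p_k$, complete homogeneous functions $h_\lambda$, and the Hall inner product $\langle\cdot,\cdot\rangle$ with $\langle p_\lambda,p_\mu\rangle=z_\lambda\delta_{\lambda\mu}$; the convention $h_0=1$, $h_{-r}=0$ for $r>0$ is used (so $H_{\nu,\mu}=0$ when $|\nu|>|\mu|$). For $k>0$, $\Xi_k$ denotes the list $1,e^{2\pi i/k},\ldots,e^{2\pi i(k-1)/k}$ of eigenvalues of a $k$-cycle permutation matrix, and for a partition $\mu$, $\Xi_\mu$ is the concatenation of $\Xi_{\mu_1},\ldots,\Xi_{\mu_{\ell(\mu)}}$. For $f\in Sym$, $f[\Xi_\mu]$ is obtained by substituting for each $p_k$ the sum of the $k$-th powers of the entries of $\Xi_\mu$ (equivalently $p_k\mapsto\sum_{d\mid k} d\, m_d(\mu)$, where $m_d(\mu)$ is the number of parts of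 $\mu$ equal to $d$). A multiset partition of a multiset $S$ is a multiset of nonempty multisets whose multiset union is $S$. For a multiset partition $\pi$, $\tilde m(\pi)$ is the partition (of the number of parts of $\pi$) whose parts are the multiplicities with which the distinct multisets occur in $\pi$. *)

(* Defs.v *)
From mathcomp Require Import all_boot all_order all_algebra.
Set Implicit Arguments. Unset Strict Implicit. Unset Printing Implicit Defensive.
Import Order.TTheory GRing.Theory Num.Theory.
Local Open Scope ring_scope.

Definition is_partition (s : seq nat) : bool :=
  sorted geq s && all (fun x => (0 < x)%N) s.

(* partsb k m n : all partitions of n with parts <= m (k is fuel, k >= n). *)
Fixpoint partsb (k m n : nat) : seq (seq nat) :=
  if n == 0%N then [:: [::]] else
  match k with
  | 0 => [::]
  | k'.+1 => flatten [seq [seq p :: s | s <- partsb k' p (n - p)]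
                      | p <- iota 1 (minn m n)]
  end.

Definition partitions (n : nat) : seq (seq nat) := partsb n n n.

Definition zee (r : seq nat) : nat :=
  \prod_(1 <= i < (sumn r).+1) (i ^ count_mem i r * (count_mem i r)`!)%N.

(* An element of Sym = Q[p_1,p_2,...] is represented as a formal Q-linear
   combination of power sums p_rho, rho a partition: a list of pairs
   (rho, coefficient).  Duplicated entries are simply added. *)
Definition symf := seq (seq nat * rat).

Definition psort (s : seq nat) : seq nat := sort geq s.

(* product, using p_rho p_sigma = p_(rho U sigma) *)
Definition smul (f g : symf) : symf :=
  [seq (psort (x.1 ++ y.1), x.2 * y.2) | x <- f, y <- g].

Definition h_sym (n : nat) : symf :=
  [seq (r, ((zee r)%:R)^-1) | r <- partitions n].

Definition h_part (nu : seq nat) : symf :=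
  foldr (fun n f => smul (h_sym n) f) [:: ([::], 1)] nu.

(* Hall inner product <f, p_mu> (mu a partition), using <p_la,p_mu> = z_la d_la,mu *)
Definition hall_p (f : symf) (mu : seq nat) : rat :=
  \sum_(x <- f | x.1 == mu) x.2 * (zee mu)%:R.

(* ring homomorphism Sym -> Q given by p_k |-> P k *)
Definition sym_eval (P : nat -> rat) (f : symf) : rat :=
  \sum_(x <- f) x.2 * \prod_(k <- x.1) P k.

(* image of p_k under f |-> f[Xi_mu]:  sum_{d | k} d m_d(mu) *)
Definition Xi_p (mu : seq nat) (k : nat) : rat :=
  (\sum_(1 <= d < k.+1 | d %| k) d * count_mem d mu)%N%:R.

Definition pleth_Xi (f : symf) (mu : seq nat) : rat := sym_eval (Xi_p mu) f.

(* H_{nu,mu} = < h_{|mu|-|nu|} h_nu , p_mu >, with h_{-r} = 0 for r > 0 *)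
Definition Hnm (nu mu : seq nat) : rat :=
  if (sumn nu <= sumn mu)%N
  then hall_p (smul (h_sym (sumn mu - sumn nu)) (h_part nu)) mu
  else 0.

(* A (sub)multiset of {1,...,l} (l = size la) is its multiplicity function;
   element i+1 is indexed by i : 'I_l.  Multiplicities are bounded by |la|. *)
Definition mblock (la : seq nat) := {ffun 'I_(size la) -> 'I_(sumn la).+1}.

(* A multiset of such multisets is again a multiplicity function
   (multiplicities are bounded by |la|, since blocks are nonempty). *)
Definition mset_of_blocks (la : seq nat) := {ffun mblock la -> 'I_(sumn la).+1}.

Definition is_mset_partition (la : seq nat) (pi : mset_of_blocks la) : bool :=
  [forall b : mblock la, (pi b != ord0) ==> [exists i, b i != ord0]] &&
  [forall i : 'I_(size la),
     (\sum_(b : mblock la) pi b * b i)%N == nth 0%N la i].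

Definition mtilde (la : seq nat) (pi : mset_of_blocks la) : seq nat :=
  sort geq [seq nat_of_ord (pi b) | b <- enum (mblock la) & pi b != ord0].

(* Main.v *)
(* Both sides count the ways of labelling every part mu_j by a vector B_j of l natural
   numbers so that sum_j mu_j B_j = la.
   On the left, Newton's identities say that sum_n h_n[P] t^n is the exponential of
   sum_(k > 0) P_k t^k / k.  Hence sum_n h_n[Xi_mu] t^n is the product of the geometric
   series 1 / (1 - t^mu_j), and each h_(la_i)[Xi_mu] counts the possible i-th coordinates
   of the labels.
   On the right, multiplication by p_k is adjoint to the derivation k d/dp_k, which maps
   h_n to h_(n-k); removing the parts of mu one at a time with the Leibniz rule,
   <h_nu, p_mu> counts the distributions of the parts of mu over bins of total sizes nu.
   Taking the nonzero vectors as bins, together with a bin for the zero vector provided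
   by h_(|mu|-|nu|), a labelling determines the multiset partition in which every nonempty
   block has multiplicity the total size of the parts that it labels. *)
From HB Require Import structures.
From mathcomp Require Import all_boot all_order all_algebra.
From mathcomp Require Import zify ring mpoly.
Require Import Defs.
Set Implicit Arguments. Unset Strict Implicit. Unset Printing Implicit Defensive.
Import Order.TTheory GRing.Theory Num.Theory.
Local Open Scope ring_scope.

Lemma geq_trans : transitive geq.
Proof. by move=> n m p /= nm /leq_trans; apply. Qed.

Lemma geq_anti : antisymmetric geq.
Proof. by move=> m n /= mn; apply/eqP; rewrite eqn_leq andbC. Qed.

Lemma perm_psort s : perm_eq (psort s) s.
Proof. by rewrite perm_sort. Qed.

Lemma psort_sorted s : sorted geq (psort s).
Proof. by apply: sort_sorted => m n; exact: leq_total. Qed.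

Lemma leq_sumn k s : k \in s -> (k <= sumn s)%N.
Proof. by move=> /perm_to_rem/perm_sumn -> /=; exact: leq_addr. Qed.

Lemma is_partition_psort s :
  all (fun x => 0 < x)%N s -> is_partition (psort s).
Proof. by rewrite /is_partition psort_sorted (perm_all _ (perm_psort s)). Qed.

Lemma is_partition_perm_eq r s :
  is_partition r -> is_partition s -> perm_eq r s -> r = s.
Proof. by move=> /andP[+ _] /andP[+ _]; exact: sorted_eq geq_trans geq_anti _ _. Qed.

Lemma is_partition_rem k s : is_partition s -> is_partition (rem k s).
Proof.
move=> /andP[s_sorted s_gt0].
rewrite /is_partition (subseq_sorted geq_trans (rem_subseq k s)) //=.
by apply/allP => x /mem_rem/(allP s_gt0).
Qed.

Lemma mem_partsb k m n s : (n <= k)%N ->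
  (s \in partsb k m n) =
  [&& path geq m s, all (fun x => 0 < x)%N s & sumn s == n].
Proof.
elim: k m n s => [|k IH] m [|n] s //= le_nk;
  do ?[by rewrite inE; case: s => [|[|p] s] //=; rewrite ?andbF].
apply/flatten_mapP/idP => [[p]|].
  rewrite mem_iota => p_range /mapP[t + ->] /=.
  by rewrite IH; [move=> /and3P[-> -> /eqP ->]; lia | lia].
case: s => [|p s] //= /and3P[/andP[le_pm s_path] /andP[p_gt0 s_gt0] /eqP sum_ps].
exists p; first by rewrite mem_iota; lia.
by apply: map_f; rewrite IH ?s_path ?s_gt0 /=; lia.
Qed.

Lemma partsb_uniq k m n : uniq (partsb k m n).
Proof.
elim: k m n => [|k IH] m n /=; case: ifP => // _.
apply: allpairs_uniq_dep => [|p _|]; [exact: iota_uniq | exact: IH |].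
by move=> [p s] [q t] _ _ /= [-> ->].
Qed.

Lemma mem_partitions n s : (s \in partitions n) = is_partition s && (sumn s == n).
Proof.
rewrite /partitions mem_partsb // /is_partition -andbA.
case: s => [|p s] //=; case: eqP => [<-|]; rewrite ?andbF // !andbT.
by rewrite leq_addr.
Qed.

Lemma partitions_uniq n : uniq (partitions n).
Proof. exact: partsb_uniq. Qed.

Lemma perm_partitions_rem k n : (0 < k <= n)%N ->
  perm_eq [seq r <- partitions n | k \in r]
          [seq psort (k :: s) | s <- partitions (n - k)].
Proof.
move=> /andP[k_gt0 le_kn]; apply: uniq_perm.
- by rewrite filter_uniq ?partitions_uniq.
- rewrite map_inj_in_uniq ?partitions_uniq // => r s.
  rewrite !mem_partitions => /andP[r_part _] /andP[s_part _] eq_krs.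
  apply: is_partition_perm_eq; rewrite // -(perm_cons k).
  by rewrite -(perm_sort geq) -[sort _ _]/(psort _) eq_krs perm_psort.
move=> r; rewrite mem_filter mem_partitions; apply/idP/mapP.
  move=> /and3P[k_r r_part /eqP sum_r]; have perm_kr := perm_to_rem k_r.
  exists (rem k r).
    rewrite mem_partitions is_partition_rem // -sum_r (perm_sumn perm_kr) /=.
    by rewrite addKn eqxx.
  apply: is_partition_perm_eq => //; last first.
    by rewrite (perm_trans perm_kr) // perm_sym perm_psort.
  by apply: is_partition_psort; rewrite -(perm_all _ perm_kr); case/andP: r_part.
move=> [s]; rewrite mem_partitions => /andP[/andP[_ s_gt0] /eqP sum_s] ->.
rewrite (perm_mem (perm_psort _)) mem_head is_partition_psort /= ?k_gt0 //.
by rewrite (perm_sumn (perm_psort _)) /= sum_s subnKC.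
Qed.

Lemma zee_bound N r : (sumn r <= N)%N ->
  zee r = (\prod_(1 <= i < N.+1) (i ^ count_mem i r * (count_mem i r)`!))%N.
Proof.
move=> le_rN; rewrite [RHS](big_cat_nat _ (n := (sumn r).+1)) //=.
rewrite [X in (_ * X)%N]big_nat [X in (_ * X)%N]big1 ?muln1 // => i /andP[lt_ri _].
suff /count_memPn -> : i \notin r by [].
by apply: contraTN lt_ri => /leq_sumn; rewrite -leqNgt.
Qed.

Lemma perm_zee r s : perm_eq r s -> zee r = zee s.
Proof.
by move=> eq_rs; rewrite /zee (perm_sumn eq_rs); under eq_bigr do rewrite (permP eq_rs).
Qed.

Lemma zee_cons k r : (0 < k)%N -> zee (k :: r) = (k * (count_mem k r).+1 * zee r)%N.
Proof.
move=> k_gt0; rewrite (@zee_bound (k + sumn r) r) ?leq_addl // /zee /=.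
have k_range : k \in index_iota 1 (k + sumn r).+1 by rewrite mem_index_iota; lia.
rewrite !(bigD1_seq k k_range (iota_uniq _ _)) /= eqxx add1n factS expnS.
under eq_bigr => i /negPf i_neq_k do rewrite [k == i]eq_sym i_neq_k add0n.
by ring.
Qed.


(* For [F] the product of the power sums, this is [k d/dp_k h_n = h_(n-k)]. *)
Lemma sum_partitions_rem (V : lmodType rat) (F : seq nat -> V) k n : (0 < k)%N ->
  \sum_(r <- partitions n)
    ((zee r)%:R^-1 * (k * count_mem k r)%:R) *: F (rem k r) =
  if (k <= n)%N then \sum_(s <- partitions (n - k)) (zee s)%:R^-1 *: F s else 0.
Proof.
move=> k_gt0; rewrite (bigID (fun r => k \in r)) /= addrC big1 ?add0r; last first.
  by move=> r /count_memPn ->; rewrite muln0 mulr0 scale0r.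
case: leqP => [le_kn|lt_nk]; last first.
  rewrite big_seq_cond big1 // => r /andP[].
  by rewrite mem_partitions => /andP[_ /eqP sum_r] /perm_to_rem/perm_sumn /=; lia.
rewrite -big_filter (perm_big _ (perm_partitions_rem _)) ?k_gt0 //= big_map !big_seq.
apply: eq_bigr => s; rewrite mem_partitions => /andP[s_part _].
have perm_ks := perm_psort (k :: s).
have -> : rem k (psort (k :: s)) = s.
  apply: is_partition_perm_eq => //.
    apply/is_partition_rem/is_partition_psort; rewrite /= k_gt0.
    by case/andP: s_part.
  rewrite -(perm_cons k) (perm_trans _ perm_ks) // perm_sym perm_to_rem //.
  by rewrite (perm_mem perm_ks) mem_head.
rewrite (permP perm_ks) (perm_zee perm_ks) zee_cons //= eqxx add1n natrM invfM.
by rewrite mulrAC mulVf ?mul1r // pnatr_eq0 muln_eq0 negb_or -lt0n k_gt0.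
Qed.

Section PowerSumEvaluation.

Variables (A : comAlgType rat) (P : nat -> A).

Definition psum_eval (f : symf) : A := \sum_(x <- f) x.2 *: \prod_(k <- x.1) P k.

Lemma psum_eval_smul f g : psum_eval (smul f g) = psum_eval f * psum_eval g.
Proof.
rewrite /psum_eval big_allpairs_dep mulr_suml; apply: eq_bigr => x _ /=.
rewrite mulr_sumr; apply: eq_bigr => y _.
by rewrite (perm_big _ (perm_psort _)) big_cat -scalerAl -scalerAr scalerA.
Qed.

Lemma psum_eval_h_part s :
  psum_eval (h_part s) = \prod_(n <- s) psum_eval (h_sym n).
Proof.
elim: s => [|n s IH] /=; first by rewrite /psum_eval big_seq1 !big_nil scale1r.
by rewrite psum_eval_smul big_cons IH.
Qed.

Lemma psum_eval_hE n :
  psum_eval (h_sym n) = \sum_(r <- partitions n) (zee r)%:R^-1 *: \prod_(k <- r) P k.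
Proof. exact: big_map. Qed.

Lemma psum_eval_h0 : psum_eval (h_sym 0) = 1.
Proof. by rewrite psum_eval_hE big_seq1 /zee big_geq // big_nil invr1 scale1r. Qed.

End PowerSumEvaluation.

Section CauchyProduct.

Variable R : comNzRingType.
Implicit Types (a b P Q : nat -> R) (p q r : {poly R}).

Definition cauchy_prod a b (n : nat) : R := \sum_(i < n.+1) a i * b (n - i)%N.

Lemma coef_cauchy_prod a b p q n :
    (forall i, (i <= n)%N -> p`_i = a i) -> (forall i, (i <= n)%N -> q`_i = b i) ->
  (p * q)`_n = cauchy_prod a b n.
Proof.
move=> pE qE; rewrite coefM; apply: eq_bigr => -[i /= lt_in] _.
by rewrite pE ?qE ?leq_subr.
Qed.

Lemma eq_coefMl p q r n :
  (forall i, (i <= n)%N -> p`_i = q`_i) -> (p * r)`_n = (q * r)`_n.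
Proof.
by move=> eq_pq; rewrite !coefM; apply: eq_bigr => i _; rewrite eq_pq // -ltnS.
Qed.

(* The Taylor coefficients of [exp (\sum_(k > 0) P k * t ^ k / k)]. *)
Definition newton_seq P a : Prop :=
  a 0%N = 1 /\ forall n, a n.+1 *+ n.+1 = cauchy_prod (fun k => P k.+1) a n.

Lemma newton_seq_cauchy_prod P Q a b :
  newton_seq P a -> newton_seq Q b -> newton_seq (fun k => P k + Q k) (cauchy_prod a b).
Proof.
move=> [a0 aS] [b0 bS]; split=> [|n].
  by rewrite /cauchy_prod big_ord1 subnn a0 b0 mulr1.
pose pol (c : nat -> R) := \poly_(i < n.+2) c i.
have polE c i : (i < n.+2)%N -> (pol c)`_i = c i by move=> i_n; rewrite coef_poly i_n.
have derivE c S : (forall m, c m.+1 *+ m.+1 = cauchy_prod (fun k => S k.+1) c m) ->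
    forall i, (i <= n)%N -> ((pol c)^`())`_i = (pol (fun k => S k.+1) * pol c)`_i.
  move=> cS i le_in; rewrite coef_deriv polE ?ltnS // cS.
  by apply/esym/coef_cauchy_prod => j le_ji; apply: polE; lia.
transitivity (((pol a * pol b)^`())`_n).
  by rewrite coef_deriv; congr (_ *+ _); apply/esym/coef_cauchy_prod => i ?; rewrite polE.
rewrite derivM coefD (eq_coefMl _ (derivE _ _ aS)).
rewrite [pol a * _]mulrC (eq_coefMl _ (derivE _ _ bS)) -coefD.
rewrite (_ : _ + _ = (pol (fun k => P k.+1) + pol (fun k => Q k.+1)) * (pol a * pol b));
  last by ring.
apply: coef_cauchy_prod => i le_in; first by rewrite coefD !polE //; lia.
by apply: coef_cauchy_prod => j le_ji; apply: polE; lia.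
Qed.

End CauchyProduct.

Lemma newton_seq_unique (A : comAlgType rat) (P a b : nat -> A) :
  newton_seq P a -> newton_seq P b -> a =1 b.
Proof.
move=> [a0 aS] [b0 bS] n; have [m] := ubnP n; elim: m n => // m IH [|n] lt_nm.
  by rewrite a0 b0.
have n_neq0 : n.+1%:R != 0 :> rat by rewrite pnatr_eq0.
apply: (scalerI n_neq0); rewrite !scaler_nat aS bS; apply: eq_bigr => i _.
by rewrite IH //; lia.
Qed.

Lemma sumn_count_mem n r : (sumn r <= n)%N ->
  (\sum_(i < n) i.+1 * count_mem i.+1 r)%N = sumn r.
Proof.
elim: r => [|[|p] r IH] //=; first by rewrite big1 // => i; rewrite muln0.
move=> le_prn; under eq_bigr do rewrite mulnDr.
rewrite big_split /= IH //; last by lia.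
have lt_pn : (p < n)%N by lia.
rewrite (bigD1 (Ordinal lt_pn)) //= eqxx muln1 big1 ?addn0 // => i.
by rewrite -val_eqE eqSS eq_sym => /negPf /= ->; rewrite muln0.
Qed.

Lemma newton_seq_h (A : comAlgType rat) (P : nat -> A) :
  newton_seq P (fun n => psum_eval P (h_sym n)).
Proof.
split=> [|n]; first exact: psum_eval_h0.
transitivity (\sum_(i < n.+1) P i.+1 * \sum_(r <- partitions n.+1)
    ((zee r)%:R^-1 * (i.+1 * count_mem i.+1 r)%:R) *: \prod_(k <- rem i.+1 r) P k);
  last first.
  apply: eq_bigr => i _; rewrite (sum_partitions_rem (fun s => \prod_(k <- s) P k)) //.
  by rewrite ltn_ord subSS psum_eval_hE.
under eq_bigr do rewrite mulr_sumr.
rewrite exchange_big psum_eval_hE -sumrMnl !big_seq; apply: eq_bigr => r.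
rewrite mem_partitions => /andP[_ /eqP sum_r].
transitivity (\sum_(i < n.+1)
    ((zee r)%:R^-1 * (i.+1 * count_mem i.+1 r)%:R) *: \prod_(k <- r) P k).
  rewrite -scaler_suml -mulr_sumr -natr_sum sumn_count_mem ?sum_r //.
  by rewrite mulrC -scalerA scaler_nat.
apply: eq_bigr => i _; have [i_r|/count_memPn ->] := boolP (i.+1 \in r); last first.
  by rewrite muln0 mulr0 !scale0r mulr0.
by rewrite (perm_big _ (perm_to_rem i_r)) big_cons scalerAr.
Qed.

Lemma psum_eval_hD (A : comAlgType rat) (P Q : nat -> A) n :
  psum_eval (fun k => P k + Q k) (h_sym n) =
  cauchy_prod (fun i => psum_eval P (h_sym i)) (fun i => psum_eval Q (h_sym i)) n.
Proof.
apply: (newton_seq_unique (newton_seq_h _)).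
exact: newton_seq_cauchy_prod (newton_seq_h P) (newton_seq_h Q).
Qed.

Lemma sum_dvdn n d : (0 < d)%N -> (\sum_(i < n) (d %| i.+1))%N = (n %/ d)%N.
Proof.
move=> d_gt0; elim: n => [|n IH]; first by rewrite big_ord0 div0n.
by rewrite big_ord_recr IH divnS // addnC.
Qed.

Lemma newton_seq_geometric (R : comNzRingType) d : (0 < d)%N ->
  newton_seq (fun k => if (d %| k)%N then d%:R else 0) (fun n => (d %| n)%:R : R).
Proof.
move=> d_gt0; split=> [|n]; first by rewrite dvdn0.
transitivity ((\sum_(i < n.+1) (d %| i.+1) * ((d %| n.+1) * d))%N%:R : R).
  rewrite -mulrnA -big_distrl /= sum_dvdn //; congr _%:R.
  by case: (boolP (d %| n.+1)%N) => [/divnK {1}<-|]; rewrite ?muln0 ?mul1n.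
rewrite natr_sum; apply: eq_bigr => i _.
have [d_i|_] := boolP (d %| i.+1)%N; last by rewrite mul0n mul0r.
by rewrite mul1n natrM mulrC -(dvdn_subl (ltn_ord i) d_i) subSS.
Qed.

Lemma pleth_XiE f mu : pleth_Xi f mu = psum_eval (Xi_p mu : nat -> rat^o) f.
Proof. by []. Qed.

Lemma Xi_p_cat mu nu k : Xi_p (mu ++ nu) k = Xi_p mu k + Xi_p nu k.
Proof.
rewrite /Xi_p -natrD -big_split /=; congr _%:R; apply: eq_bigr => d _.
by rewrite count_cat mulnDr.
Qed.

Lemma Xi_p1 d k : (0 < k)%N ->
  Xi_p [:: d] k = if (d %| k)%N then d%:R else 0.
Proof.
move=> k_gt0; rewrite /Xi_p big_mkcond /=.
under eq_bigr do rewrite addn0.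
have [d_k|d'k] := boolP (d %| k)%N.
  have d_range : d \in index_iota 1 k.+1.
    by rewrite mem_index_iota (dvdn_gt0 k_gt0) // ltnS dvdn_leq.
  rewrite (bigD1_seq d) ?iota_uniq //= d_k eqxx muln1 big1 ?addn0 // => i.
  by rewrite eq_sym => /negPf ->; rewrite muln0 if_same.
rewrite big1 // => i _; case: eqVneq => [<-|_]; last by rewrite muln0 if_same.
by rewrite (negPf d'k).
Qed.

Lemma Xi_p_nil k : Xi_p [::] k = 0.
Proof. by rewrite /Xi_p big1 // => d _; rewrite muln0. Qed.

Lemma pleth_Xi_h_cat mu nu n :
  pleth_Xi (h_sym n) (mu ++ nu) =
  cauchy_prod (fun i => pleth_Xi (h_sym i) mu) (fun i => pleth_Xi (h_sym i) nu) n.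
Proof.
rewrite -[RHS](@psum_eval_hD rat^o) pleth_XiE; apply: eq_bigr => x _.
by congr (_ * _); apply: eq_bigr => k _; exact: Xi_p_cat.
Qed.

Lemma pleth_Xi_hE mu (a : nat -> rat) :
  newton_seq (Xi_p mu) a -> forall n, pleth_Xi (h_sym n) mu = a n.
Proof. exact: (@newton_seq_unique rat^o _ _ _ (newton_seq_h _)). Qed.

Lemma pleth_Xi_h1 d n : (0 < d)%N -> pleth_Xi (h_sym n) [:: d] = (d %| n)%:R.
Proof.
move=> d_gt0; apply: (pleth_Xi_hE (a := fun m => (d %| m)%:R)).
have [g0 gS] := newton_seq_geometric rat d_gt0; split=> // m.
by rewrite gS; apply: eq_bigr => i _; rewrite Xi_p1.
Qed.

Lemma pleth_Xi_h_nil n : pleth_Xi (h_sym n) [::] = (n == 0%N)%:R.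
Proof.
apply: (pleth_Xi_hE (a := fun m => (m == 0%N)%:R)); split=> // m.
rewrite mul0rn /cauchy_prod big1 // => i _.
by rewrite Xi_p_nil mul0r.
Qed.

Lemma pleth_Xi_h_cons d mu K n : (0 < d)%N -> (n <= K)%N ->
  pleth_Xi (h_sym n) (d :: mu) =
  \sum_(c < K.+1 | (d * c <= n)%N) pleth_Xi (h_sym (n - d * c)) mu.
Proof.
move=> d_gt0 le_nK; rewrite -cat1s pleth_Xi_h_cat /cauchy_prod.
have dvdn_sum (i : 'I_n.+1) : (d %| i)%:R = \sum_(c < K.+1) (d * c == i)%:R :> rat.
  have [/dvdnP[c def_i]|d'i] := boolP (d %| i)%N; last first.
    by rewrite big1 // => c _; case: eqP d'i => // <-; rewrite dvdn_mulr.
  have lt_cK : (c < K.+1)%N by have := ltn_ord i; nia.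
  rewrite (bigD1 (Ordinal lt_cK)) //= def_i mulnC eqxx big1 ?addr0 // => e.
  by rewrite -val_eqE /= eqn_pmul2l // => /negPf ->.
under eq_bigr => i _ do rewrite pleth_Xi_h1 // dvdn_sum mulr_suml.
rewrite exchange_big [RHS]big_mkcond; apply: eq_bigr => c _ /=.
case: leqP => [le_dcn|lt_ndc]; last first.
  by rewrite big1 // => i _; rewrite gtn_eqF ?mul0r // (leq_trans (ltn_ord i)).
rewrite (bigD1 (Ordinal (le_dcn : d * c < n.+1)%N)) //= eqxx mul1r big1 ?addr0 // => i.
by rewrite -val_eqE /= eq_sym => /negPf ->; rewrite mul0r.
Qed.

(* A filling [B] of [mu] attaches the label [tnth B j] to the part [mu_j], which then adds
   [mu_j * w (tnth B j) i] to the load of the coordinate [i]. *)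
Section Fillings.

Variables (T J : finType) (w : T -> J -> nat).
Implicit Types (mu : seq nat) (v : J -> nat).

Definition load mu (B : (size mu).-tuple T) (i : J) : nat :=
  \sum_(j < size mu) nth 0%N mu j * w (tnth B j) i.

Definition fillings mu v : {set (size mu).-tuple T} :=
  [set B | [forall i, load B i == v i]].

Lemma load_nil (B : (size (@nil nat)).-tuple T) i : load B i = 0%N.
Proof. exact: big_ord0. Qed.

Lemma load_cons k mu b (B : (size mu).-tuple T) i :
  load (mu := k :: mu) [tuple of b :: B] i = (k * w b i + load B i)%N.
Proof.
rewrite /load big_ord_recl tnth0; congr (_ + _)%N.
by apply: eq_bigr => j _; rewrite tnthS.
Qed.

Lemma card_fillings_nil v : #|fillings [::] v| = [forall i, v i == 0%N].
Proof.
have fillingsE B : (B \in fillings [::] v) = [forall i, v i == 0%N].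
  by rewrite inE; apply: eq_forallb => i; rewrite load_nil eq_sym.
rewrite (eq_card fillingsE); case: [forall i, _]; last exact: card0.
by rewrite cardT -cardE card_tuple.
Qed.

Lemma card_fillings_cons k mu v :
  #|fillings (k :: mu) v| =
  (\sum_(b | [forall i, k * w b i <= v i])
     #|fillings mu (fun i => v i - k * w b i)|)%N.
Proof.
pose tcons (p : T * (size mu).-tuple T) := cons_tuple p.1 p.2.
have tcons_bij : bijective tcons.
  exists (fun B => (thead B, behead_tuple B)) => [[b B]|B].
    by rewrite /tcons theadE; congr (_, _); apply/val_inj.
  by rewrite [RHS]tuple_eta; apply/val_inj.
under [RHS]eq_bigr do rewrite -sum1_card.
rewrite -sum1_card (reindex _ (onW_bij _ tcons_bij)) pair_big_dep /=.
apply: eq_bigl => -[b B]; rewrite !inE /=.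
apply/forallP/andP => [fill|[/forallP le_v /forallP fill] i]; last first.
  by rewrite load_cons (eqP (fill i)) subnKC.
split; apply/forallP => i; rewrite -(eqP (fill i)) load_cons; first exact: leq_addr.
by rewrite addKn.
Qed.

End Fillings.

Definition bin_load (T : finType) mu (B : (size mu).-tuple T) : T -> nat :=
  load (fun b c : T => b == c) B.

Lemma load_bin_load (T J : finType) (w : T -> J -> nat) mu (B : (size mu).-tuple T) i :
  load w B i = (\sum_b bin_load B b * w b i)%N.
Proof.
under eq_bigr do rewrite big_distrl /=.
rewrite exchange_big; apply: eq_bigr => j _ /=.
rewrite (bigD1 (tnth B j)) //= eqxx muln1 big1 ?addn0 // => b.
by rewrite eq_sym => /negPf ->; rewrite muln0.
Qed.

Lemma sum_bin_load (T : finType) mu (B : (size mu).-tuple T) :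
  (\sum_b bin_load B b)%N = sumn mu.
Proof.
transitivity (load (fun _ (_ : unit) => 1%N) B tt).
  by rewrite load_bin_load; apply: eq_bigr => b _; rewrite muln1.
rewrite sumnE (big_nth 0%N) big_mkord; apply: eq_bigr => j _.
by rewrite muln1.
Qed.

Lemma prodr_bool (R : comNzRingType) (I : finType) (P : pred I) :
  \prod_i (P i)%:R = [forall i, P i]%:R :> R.
Proof.
have [/forallP allP|/forallPn[i /negPf Pi]] := boolP [forall i, P i].
  by rewrite big1 // => i _; rewrite allP.
by rewrite (bigD1 i) //= Pi mul0r.
Qed.

Lemma prod_pleth_Xi_h (J : finType) (K : nat) (v : J -> nat) mu :
    all (fun x => 0 < x)%N mu -> (forall i, v i <= K)%N ->
  \prod_i pleth_Xi (h_sym (v i)) mu =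
  #|fillings (fun (b : {ffun J -> 'I_K.+1}) i => b i : nat) mu v|%:R.
Proof.
elim: mu v => [|d mu IH] v /=.
  move=> _ _; rewrite card_fillings_nil; under eq_bigr do rewrite pleth_Xi_h_nil.
  exact: prodr_bool.
move=> /andP[d_gt0 mu_gt0] le_vK; rewrite card_fillings_cons natr_sum.
under eq_bigr => i _ do rewrite (pleth_Xi_h_cons mu d_gt0 (le_vK i)).
rewrite bigA_distr_big_dep; apply: eq_big => [f|f /forallP le_v] //.
by rewrite IH // => i; apply: leq_trans (le_vK i); rewrite leq_subr.
Qed.

Section Leibniz.

Variables (R : comNzRingType) (D : R -> R).
Hypothesis DM : forall p q, D (p * q) = D p * q + p * D q.

Lemma derivation1 : D 1 = 0.
Proof.
by apply: (addrI (D 1)); rewrite -{1}[D 1]mulr1 -{2}[D 1]mul1r -DM mulr1 addr0.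
Qed.

Lemma derivation_prod (I : finType) (F : I -> R) :
  D (\prod_i F i) = \sum_i D (F i) * \prod_(j | j != i) F j.
Proof.
elim: (index_enum I) (index_enum_uniq I) => [|a s IH] /=.
  by rewrite !big_nil derivation1.
move=> /andP[a_s s_uniq]; rewrite !big_cons DM IH // eqxx; congr (_ * _ + _).
  rewrite [RHS]big_mkcond; apply: eq_big_seq => i i_s.
  by case: eqVneq a_s => // <-; rewrite i_s.
rewrite mulr_sumr; apply: eq_big_seq => i i_s; rewrite big_cons.
by case: eqVneq a_s => [->|_ _]; [rewrite i_s | rewrite mulrCA].
Qed.

End Leibniz.

(* [{mpoly rat[N]}] is the ring of symmetric functions modulo [p_k] for [k > N], the
   power sum [p_k] being the indeterminate of index [k - 1]. *)
Section PowerSumPolynomials.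

Variable N : nat.
Implicit Types (f g : {mpoly rat[N]}) (mu r : seq nat).

Definition powsum (k : nat) : {mpoly rat[N]} := \sum_(i < N | i.+1 == k) 'X_i.

(* The adjoint of multiplication by [p_k] for the Hall inner product. *)
Definition powsum_perp (k : nat) f : {mpoly rat[N]} :=
  k%:R *: \sum_(i < N | i.+1 == k) f^`M(i).

Fact powsum_perp_is_linear k : linear (powsum_perp k).
Proof.
move=> c f g; rewrite /powsum_perp scalerA mulrC -scalerA -scalerDr; congr (_ *: _).
by rewrite scaler_sumr -big_split; apply: eq_bigr => i _; rewrite mderivD mderivZ.
Qed.

HB.instance Definition _ k :=
  GRing.isLinear.Build rat {mpoly rat[N]} {mpoly rat[N]} _ (powsum_perp k)
    (powsum_perp_is_linear k).

Lemma powsum_perpM k f g :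
  powsum_perp k (f * g) = powsum_perp k f * g + f * powsum_perp k g.
Proof.
rewrite -scalerAl -scalerAr -scalerDr mulr_suml mulr_sumr -big_split.
by congr (_ *: _); apply: eq_bigr => i _; rewrite mderivM.
Qed.

Lemma powsum_perp_powsum k j : (0 < k <= N)%N ->
  powsum_perp k (powsum j) = (k * (j == k))%:R.
Proof.
case: k => // k; rewrite /= => lt_kN; rewrite /powsum_perp /powsum.
rewrite (big_pred1 (Ordinal lt_kN)) //= (raddf_sum (mderiv _)) /=.
under eq_bigr do rewrite mderivX mnm1E.
case: eqVneq => [->|j'k].
  rewrite (big_pred1 (Ordinal lt_kN)) // eqxx scale1r -[X in (X - _)%MM]add0m addmK.
  by rewrite mpolyX0 scaler_nat muln1.
rewrite big1 ?scaler0 ?muln0 // => i /eqP i_j.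
by rewrite -val_eqE -eqSS /= i_j (negPf j'k) scale0r.
Qed.

Lemma powsum_perp_prod_powsum k r : (0 < k <= N)%N ->
  powsum_perp k (\prod_(j <- r) powsum j) =
  (k * count_mem k r)%:R *: \prod_(j <- rem k r) powsum j.
Proof.
move=> k_range; elim: r => [|j r IH].
  by rewrite muln0 scale0r big_nil derivation1 //; exact: powsum_perpM.
rewrite big_cons powsum_perpM powsum_perp_powsum // IH /=.
case: eqVneq => [->|j'k]; last first.
  by rewrite muln0 mul0r add0r big_cons scalerAr.
rewrite mulnDr muln1 natrD scalerDl -scaler_nat -scalerAl mul1r; congr (_ + _).
have [k_r|/count_memPn->] := boolP (k \in r); last by rewrite muln0 !scale0r mulr0.
by rewrite (perm_big _ (perm_to_rem k_r)) big_cons scalerAr.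
Qed.

Lemma powsum_perp_h k n : (0 < k <= N)%N ->
  powsum_perp k (psum_eval powsum (h_sym n)) =
  if (k <= n)%N then psum_eval powsum (h_sym (n - k)) else 0.
Proof.
move=> k_range; have [k_gt0 _] := andP k_range.
rewrite !psum_eval_hE -(sum_partitions_rem (fun s => \prod_(j <- s) powsum j)) //.
rewrite linear_sum; apply: eq_bigr => r _.
by rewrite linearZ /= powsum_perp_prod_powsum // scalerA.
Qed.

Definition hall_mpoly mu f : rat := (foldl (fun g k => powsum_perp k g) f mu)@_0%MM.

Lemma hall_mpoly_nil f : hall_mpoly [::] f = f@_0%MM.
Proof. by []. Qed.

Lemma hall_mpoly_cons k mu f : hall_mpoly (k :: mu) f = hall_mpoly mu (powsum_perp k f).
Proof. by []. Qed.

Fact hall_mpoly_is_linear mu : linear_for *%R (hall_mpoly mu).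
Proof.
move=> c; elim: mu => [|k mu IH] f g.
  by rewrite !hall_mpoly_nil mcoeffD mcoeffZ.
by rewrite !hall_mpoly_cons linearP IH.
Qed.

HB.instance Definition _ mu :=
  GRing.isLinear.Build rat {mpoly rat[N]} rat _ (hall_mpoly mu)
    (hall_mpoly_is_linear mu).

Lemma powsum_coef0 k : (powsum k)@_0%MM = 0.
Proof.
rewrite raddf_sum big1 //= => i _; rewrite mcoeffX.
by case: eqVneq => // /(congr1 mdeg); rewrite mdeg1 mdeg0.
Qed.

Lemma h_coef0 n : (psum_eval powsum (h_sym n))@_0%MM = (n == 0%N)%:R.
Proof.
rewrite -pleth_Xi_h_nil pleth_XiE raddf_sum; apply: eq_bigr => x _ /=.
rewrite mcoeffZ rmorph_prod; congr (_ * _); apply: eq_bigr => k _ /=.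
by rewrite powsum_coef0 Xi_p_nil.
Qed.

Lemma hall_mpoly_prod_powsum mu r : all (fun k => 0 < k <= N)%N mu ->
  hall_mpoly mu (\prod_(j <- r) powsum j) = (perm_eq r mu)%:R * (zee mu)%:R.
Proof.
elim: mu r => [|k mu IH] r.
  rewrite hall_mpoly_nil /zee big_geq // mulr1; case: r => [|j r] _.
    by rewrite big_nil mcoeff1 eqxx.
  rewrite big_cons rmorphM /= powsum_coef0 mul0r.
  by case: (boolP (perm_eq _ _)) => // /perm_size.
move=> /andP[k_range mu_range]; have [k_gt0 _] := andP k_range.
rewrite hall_mpoly_cons powsum_perp_prod_powsum // linearZ /=.
rewrite IH // zee_cons //; have [k_r|k'r] := boolP (k \in r); last first.
  rewrite (count_memPn k'r) muln0 mul0r; case: (boolP (perm_eq r _)) => [perm_r|_].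
    by rewrite (perm_mem perm_r) mem_head in k'r.
  by rewrite mul0r.
rewrite -(perm_cons k) -(permPl (perm_to_rem k_r)).
case: (boolP (perm_eq r _)) => [perm_r|_]; last by rewrite !mul0r mulr0.
by rewrite (permP perm_r) /= eqxx add1n !mul1r -natrM.
Qed.

Lemma hall_p_mpoly (f : symf) mu :
    all (fun x => sorted geq x.1) f -> sorted geq mu ->
    all (fun k => 0 < k <= N)%N mu ->
  hall_p f mu = hall_mpoly mu (psum_eval powsum f).
Proof.
move=> f_sorted mu_sorted mu_range.
rewrite linear_sum /hall_p big_mkcond; apply: eq_big_seq => x /(allP f_sorted) x_sorted.
rewrite linearZ /= hall_mpoly_prod_powsum //.
have -> : perm_eq x.1 mu = (x.1 == mu).
  apply/idP/eqP => [|-> //]; exact: sorted_eq geq_trans geq_anti _ _ x_sorted mu_sorted.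
by case: eqP; rewrite ?mul1r // mul0r mulr0.
Qed.

Lemma hall_mpoly_prod_h (I : finType) (nu : I -> nat) mu :
    all (fun k => 0 < k <= N)%N mu ->
  hall_mpoly mu (\prod_b psum_eval powsum (h_sym (nu b))) =
  #|[set B : (size mu).-tuple I | [forall b, bin_load B b == nu b]]|%:R.
Proof.
rewrite -[[set B | _]]/(fillings _ mu nu).
elim: mu nu => [|k mu IH] nu.
  move=> _; rewrite card_fillings_nil hall_mpoly_nil rmorph_prod /=.
  by under eq_bigr do rewrite h_coef0; exact: prodr_bool.
move=> /andP[k_range mu_range].
rewrite card_fillings_cons natr_sum hall_mpoly_cons.
rewrite (derivation_prod (powsum_perpM k)) linear_sum [RHS]big_mkcond /=.
apply: eq_bigr => b _; rewrite powsum_perp_h //.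
have -> : [forall c, (k * (b == c) <= nu c)%N] = (k <= nu b)%N.
  apply/forallP/idP => [/(_ b)|le_knu c]; first by rewrite eqxx muln1.
  by case: eqP => [<-|_]; rewrite ?muln1 ?muln0.
case: ifP => le_knu; last by rewrite mul0r linear0.
rewrite -IH //; congr (hall_mpoly mu _); rewrite [RHS](bigD1 b) //= eqxx muln1.
congr (_ * _); apply: eq_bigr => c /negPf c_b.
by rewrite eq_sym c_b muln0 subn0.
Qed.

End PowerSumPolynomials.

Lemma slack_bin_load (T : finType) (b0 : T) (nu : T -> nat) mu (B : (size mu).-tuple T) :
    (forall b, b != b0 -> bin_load B b = nu b) ->
  (bin_load B b0 + \sum_(b | b != b0) nu b)%N = sumn mu.
Proof.
by move=> eq_nu; rewrite -(sum_bin_load B) [RHS](bigD1 b0) //= [in RHS](eq_bigr _ eq_nu).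
Qed.

Lemma smul_sorted f g : all (fun x => sorted geq x.1) (smul f g).
Proof. by apply/allP => x /allpairsP[p [_ _ ->]]; exact: psort_sorted. Qed.

Lemma big_psort_neq0 (R : Type) (idx : R) (op : Monoid.com_law idx) (F : nat -> R)
    (T : finType) (b0 : T) (nu : T -> nat) : nu b0 = 0%N -> F 0%N = idx ->
  \big[op/idx]_(n <- psort [seq nu b | b <- enum T & nu b != 0%N]) F n =
  \big[op/idx]_(b | b != b0) F (nu b).
Proof.
move=> nu_b0 F0; rewrite (perm_big _ (perm_psort _)) big_map big_filter big_enum_cond /=.
rewrite [LHS]big_mkcond [RHS]big_mkcond; apply: eq_bigr => b _.
by case: (eqVneq b b0) => [->|_] /=; [rewrite nu_b0 | case: eqP => [->|]].
Qed.

(* The bin [b0] receives the parts of [mu] that the factor [h_(|mu| - |nu|)] of [Hnm]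
   accounts for. *)
Lemma Hnm_card (T : finType) (b0 : T) (nu : T -> nat) mu :
    nu b0 = 0%N -> is_partition mu ->
  Hnm (psort [seq nu b | b <- enum T & nu b != 0%N]) mu =
  #|[set B : (size mu).-tuple T | [forall (b | b != b0), bin_load B b == nu b]]|%:R.
Proof.
move=> nu_b0 /andP[mu_sorted mu_gt0]; set s := psort _.
have sum_s : sumn s = (\sum_(b | b != b0) nu b)%N by rewrite sumnE; exact: big_psort_neq0.
rewrite /Hnm; case: leqP => [le_s_mu|lt_mu_s]; last first.
  rewrite eq_card0 // => B; rewrite inE; apply/negbTE/negP => /forall_inP eq_nu.
  have := slack_bin_load (fun b b'b0 => eqP (eq_nu b b'b0)).
  by rewrite -sum_s; lia.
have mu_range : all (fun k => 0 < k <= sumn mu)%N mu.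
  by apply/allP => k k_mu; rewrite (allP mu_gt0) ?leq_sumn.
rewrite (hall_p_mpoly (smul_sorted _ _) mu_sorted mu_range).
pose nu' b := if b == b0 then (sumn mu - sumn s)%N else nu b.
transitivity (hall_mpoly mu (\prod_b psum_eval (@powsum (sumn mu)) (h_sym (nu' b)))).
  rewrite psum_eval_smul psum_eval_h_part (big_psort_neq0 _ nu_b0) ?psum_eval_h0 //.
  rewrite [in RHS](bigD1 b0) //= {1}/nu' eqxx; congr (hall_mpoly _ (_ * _)).
  by apply: eq_bigr => b; rewrite /nu' => /negPf ->.
rewrite hall_mpoly_prod_h //; congr _%:R; apply: eq_card => B; rewrite !inE.
apply/forallP/forall_inP => [eq_nu' b /negPf b'b0|eq_nu b].
  by rewrite (eqP (eq_nu' b)) /nu' b'b0.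
rewrite /nu'; case: (eqVneq b b0) => [->|]; last exact: eq_nu.
have := slack_bin_load (fun b b'b0 => eqP (eq_nu b b'b0)).
by rewrite -sum_s => <-; rewrite addnK.
Qed.

Section MultisetPartitions.

Variable la : seq nat.

Definition empty_block : mblock la := [ffun=> ord0].

Definition block_mult (b : mblock la) (i : 'I_(size la)) : nat := b i.

Lemma block_neq_empty (b : mblock la) : (b != empty_block) = [exists i, b i != ord0].
Proof.
apply/idP/existsP => [|[i]]; last by apply: contraNneq => ->; rewrite ffunE.
move=> b_neq0; apply/existsP; apply: contraNT b_neq0 => /existsPn b0.
by apply/eqP/ffunP => i; rewrite ffunE; apply/eqP; rewrite -[_ == _]negbK b0.
Qed.

Lemma mset_partition_empty (pi : mset_of_blocks la) :
  is_mset_partition pi -> pi empty_block = ord0.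
Proof.
move=> /andP[/forallP/(_ empty_block)].
by rewrite -block_neq_empty eqxx implybF negbK => /eqP.
Qed.

Variable mu : seq nat.
Implicit Type B : (size mu).-tuple (mblock la).

Lemma load_block_mult (pi : mblock la -> nat) B i :
  (forall b, b != empty_block -> bin_load B b = pi b) ->
  load block_mult B i = (\sum_b pi b * b i)%N.
Proof.
move=> loadE; rewrite load_bin_load; apply: eq_bigr => b _.
by case: (eqVneq b empty_block) => [->|/loadE <- //]; rewrite /block_mult ffunE !muln0.
Qed.

Definition blocks_of_filling B : mset_of_blocks la :=
  [ffun b => if b == empty_block then ord0 else inord (bin_load B b)].

Lemma blocks_of_fillingE B b :
    B \in fillings block_mult mu (nth 0%N la) -> b != empty_block ->
  blocks_of_filling B b = bin_load B b :> nat.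
Proof.
rewrite inE => /forallP loadB b_neq0; rewrite ffunE (negPf b_neq0) inordK // ltnS.
move: b_neq0; rewrite block_neq_empty => /existsP[i b_i].
have := mem_nth 0%N (ltn_ord i) => /leq_sumn; apply: leq_trans.
rewrite -(eqP (loadB i)) load_bin_load (bigD1 b) //= (leq_trans _ (leq_addr _ _)) //.
by rewrite leq_pmulr // lt0n.
Qed.

Lemma mset_partition_filling (pi : mset_of_blocks la) B :
  is_mset_partition pi && [forall (b | b != empty_block), bin_load B b == pi b] =
  (B \in fillings block_mult mu (nth 0%N la)) && (blocks_of_filling B == pi).
Proof.
apply/andP/andP => [[pi_part /forall_inP load_pi]|[fillB /eqP <-]].
  have loadE b b_neq0 := eqP (load_pi b b_neq0).
  have fillB : B \in fillings block_mult mu (nth 0%N la).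
    rewrite inE; apply/forallP => i; rewrite (load_block_mult _ loadE).
    by case/andP: pi_part => _ /forallP.
  split=> //; apply/eqP/ffunP => b; apply: val_inj => /=.
  have [->|b_neq0] := eqVneq b empty_block; last by rewrite blocks_of_fillingE ?loadE.
  by rewrite (mset_partition_empty pi_part) ffunE eqxx.
have loadE b (b_neq0 : b != empty_block) := esym (blocks_of_fillingE fillB b_neq0).
split; last by apply/forall_inP => b b_neq0; apply/eqP/loadE.
apply/andP; split; apply/forallP.
  move=> b; apply/implyP; rewrite -block_neq_empty.
  by apply: contraNneq => ->; rewrite ffunE eqxx.
by move=> i; rewrite -(load_block_mult _ loadE); move: fillB; rewrite inE => /forallP.
Qed.

Lemma sum_mset_partition_card :
  (\sum_(pi : mset_of_blocks la | is_mset_partition pi)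
     #|[set B : (size mu).-tuple (mblock la)
        | [forall (b | b != empty_block), bin_load B b == pi b]]|)%N =
  #|fillings block_mult mu (nth 0%N la)|.
Proof.
rewrite -[RHS]sum1_card.
rewrite (partition_big blocks_of_filling (@is_mset_partition la)) => [|B fillB].
  apply: eq_bigr => pi pi_part; rewrite -sum1_card; apply: eq_bigl => B.
  by rewrite inE -mset_partition_filling pi_part.
by have := mset_partition_filling (blocks_of_filling B) B; rewrite fillB eqxx => /andP[].
Qed.

End MultisetPartitions.

Theorem theorem2 (la mu : seq nat)
  (hla : is_partition la) (hmu : is_partition mu) :
  pleth_Xi (h_part la) mu =
  \sum_(pi : mset_of_blocks la | is_mset_partition pi) Hnm (mtilde pi) mu.
Proof.
have [_ mu_gt0] := andP hmu.
transitivity (#|fillings (@block_mult la) mu (nth 0%N la)|%:R : rat).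
  rewrite pleth_XiE psum_eval_h_part (big_nth 0%N) big_mkord.
  apply: (prod_pleth_Xi_h (v := fun i : 'I_(size la) => nth 0%N la i)) => // i.
  by apply/leq_sumn/mem_nth.
rewrite -sum_mset_partition_card natr_sum; apply: eq_bigr => pi pi_part.
apply/esym/(Hnm_card (nu := fun b => nat_of_ord (pi b))) => //.
by rewrite (mset_partition_empty pi_part).
Qed.
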